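(* For every real $x\ge 1$, we have $$\theta(x,1)+\frac{1}{24x^5}-\frac{5}{48x^6}<\psi'(x+1)<\theta(x,1)+\frac{1}{24x^5}$$ and $$\theta(x,2)-\frac{1}{45x^7}<\psi'(x+1)<\theta(x,2)-\frac{1}{45x^7}+\frac{7}{90x^8},$$ where $\theta(x,m)=\dfrac{e^{m/(x+1)}-e^{-m/x}}{2m}$.
   Context: $\Gamma(z)=\int_0^\infty t^{z-1}e^{-t}\,dt$ for $\Re(z)>0$ is the classical Euler gamma function; $\psi(z)=\frac{d}{dz}[\ln\Gamma(z)]=\frac{\Gamma'(z)}{\Gamma(z)}$ is the digamma function; and its derivative $\psi'$ is the trigamma function. For $x>0$ and a parameter $m$ (here $m=1$ or $m=2$), $\theta(x,m)=\frac{e^{m/(x+1)}-e^{-m/x}}{2m}$. *)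

(* Defs.v *)
From Stdlib Require Import Reals.
From Coquelicot Require Import Coquelicot.
Open Scope R_scope.

(* Euler's integral restricted to real arguments x > 0.  [Rpower t y] is
   exp (y ln t), the intended power for t > 0; the integral is improper at
   both ends (for 0 < x < 1 the integrand is unbounded near 0). *)
Definition Gamma (x : R) : R :=
  RInt_gen (fun t : R => Rpower t (x - 1) * exp (- t))
    (at_right 0) (Rbar_locally p_infty).

Definition digamma (x : R) : R := Derive (fun z : R => ln (Gamma z)) x.

Definition trigamma (x : R) : R := Derive digamma x.

Definition theta (x m : R) : R :=
  (exp (m / (x + 1)) - exp (- (m / x))) / (2 * m).

(* Main.v *)
Require Import Defs.
From Stdlib Require Import Reals Factorial Lra Lia Classical.
From Coquelicot Require Import Coquelicot.
Open Scope R_scope.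

(** The bounds follow from the asymptotic series of the trigamma function at
    infinity. The two expressions [theta x 1 + 1 / (24 x^5)] and
    [theta x 2 - 1 / (45 x^7)] expand, in powers of [1 / x], like that series up
    to the order of the stated error terms. So it is enough to enclose
    [trigamma (x + 1)] between consecutive truncations of the series
    ([stirling9_le_trigamma], [trigamma_le_stirling7]) and to replace the
    exponentials in [theta] by Taylor polynomials ([theta_lower],
    [theta_upper]). What remains are inequalities between rational functions on
    [x >= 1]; in the variable [x - 1] the difference of the two sides is a
    quotient of polynomials with nonnegative coefficients.

    The enclosure by truncations comes from the identity
    [trigamma x = sum of 1 / (x + k)^2 over k >= 0] ([trigamma_is_series]): if
    [A] vanishes at infinity and [A y - A (y + 1)] compares with
    [1 / (y + 1)^2], then summing over [y = x + k] compares [A x] with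
    [trigamma (x + 1)].

    The identity is obtained from Euler's integral without differentiating under
    the integral sign, in the spirit of the Bohr-Mollerup theorem. The function
    [g = ln Gamma] is convex, by Hölder's inequality ([ln_Gamma_convex]), and
    satisfies [g (x + 1) = g x + ln x], by integration by parts ([Gamma_succ]).
    Convexity places the chord slopes of [g] near [y] between [ln (y - 1)] and
    [ln y] ([bohr_mollerup_chord]), an uncertainty that tends to zero as [y]
    grows. Shifting [x] to [x + n] by the difference equation then shows
    that [g] is differentiable, with derivative
    [lim (ln (x + n) - sum of 1 / (x + k) over k < n)]
    ([bohr_mollerup_derive]). This explicit limit can be expanded to first order
    uniformly in [n] ([digamma_upper_expansion]), which yields its derivative.
    The argument of [trigamma] in the theorem is at least 2, so only
    [Gamma] on [[1, +oo)] enters, where the integrand is bounded near 0. *)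

(** * Euler's integral on [1, +oo) *)

Lemma ball_between (x y : R) (eps : posreal) :
  ball x eps y <-> - eps < y - x < eps.
Proof. apply Rabs_lt_between. Qed.

Lemma improper_domain (P : R -> Prop) :
  (forall t, 0 < t -> P t) ->
  filter_prod (at_right 0) (Rbar_locally p_infty)
    (fun ab => forall t,
      Rmin (fst ab) (snd ab) <= t <= Rmax (fst ab) (snd ab) -> P t).
Proof.
  intros HP.
  apply (Filter_prod _ _ _ (fun a => 0 < a) (fun b => 0 < b)).
  - exists (mkposreal 1 Rlt_0_1); intros y _ Hy; exact Hy.
  - exists 0; intros y Hy; exact Hy.
  - intros a b Ha Hb t [Ht _]; apply HP; simpl in Ht.
    apply Rlt_le_trans with (2 := Ht). now apply Rmin_glb_lt.
Qed.

Lemma ex_RInt_pos (f : R -> R) :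
  (forall t, 0 < t -> continuous f t) ->
  forall a b, 0 < a -> 0 < b -> ex_RInt f a b.
Proof.
  intros Hf a b Ha Hb; apply (ex_RInt_continuous f).
  intros z [Hz _]; apply Hf.
  apply Rlt_le_trans with (2 := Hz). now apply Rmin_glb_lt.
Qed.

Lemma RInt_nonneg_widen (f : R -> R) :
  (forall t, 0 < t -> continuous f t) ->
  (forall t, 0 < t -> 0 <= f t) ->
  forall a b c d, 0 < a -> a <= c -> c <= d -> d <= b ->
  RInt f c d <= RInt f a b.
Proof.
  intros Hc Hp a b c d Ha Hac Hcd Hdb.
  assert (E := ex_RInt_pos f Hc).
  assert (H1 : plus (RInt f a c) (RInt f c d) = RInt f a d)
    by (apply (RInt_Chasles f); apply E; lra).
  assert (H2 : plus (RInt f a d) (RInt f d b) = RInt f a b)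
    by (apply (RInt_Chasles f); apply E; lra).
  assert (H3 : 0 <= RInt f a c)
    by (apply RInt_ge_0; [lra | apply E; lra | intros; apply Hp; lra]).
  assert (H4 : 0 <= RInt f d b)
    by (apply RInt_ge_0; [lra | apply E; lra | intros; apply Hp; lra]).
  unfold plus in H1, H2; simpl in H1, H2; lra.
Qed.

(** The integrals over compact intervals grow with the interval, so their
    supremum is the value of the improper integral. *)
Lemma is_RInt_gen_nonneg_bounded (f : R -> R) (M : R) :
  (forall t, 0 < t -> continuous f t) ->
  (forall t, 0 < t -> 0 <= f t) ->
  (forall a b, 0 < a -> a <= b -> RInt f a b <= M) ->
  exists l, is_RInt_gen f (at_right 0) (Rbar_locally p_infty) l
    /\ forall a b, 0 < a -> a <= b -> RInt f a b <= l.
Proof.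
  intros Hc Hp HM.
  set (E := fun y => exists a b, 0 < a /\ a <= b /\ y = RInt f a b).
  destruct (completeness E) as [l [Hub Hlub]].
  { exists M; intros y (a & b & Ha & Hab & ->); now apply HM. }
  { exists (RInt f 1 1), 1, 1; repeat split; lra. }
  assert (Hl : forall a b, 0 < a -> a <= b -> RInt f a b <= l).
  { intros a b Ha Hab; apply Hub; now exists a, b. }
  exists l; split; [| exact Hl].
  intros P [eps HP].
  destruct (classic (exists a b, 0 < a /\ a <= b /\ l - eps < RInt f a b))
    as [(a0 & b0 & Ha0 & Hab0 & H0) | Hno].
  - unfold filtermapi.
    apply (Filter_prod _ _ _ (fun a => 0 < a < a0) (fun b => b0 < b)).
    + exists (mkposreal a0 Ha0); intros y Hy Hy0.
      apply ball_between in Hy; simpl in Hy; lra.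
    + now exists b0.
    + intros a b Ha Hb; exists (RInt f a b); split.
      * apply (RInt_correct f). apply ex_RInt_pos; simpl; try assumption; lra.
      * apply HP.
        assert (H1 := RInt_nonneg_widen f Hc Hp a b a0 b0).
        assert (H2 := Hl a b).
        assert (H3 := cond_pos eps).
        apply ball_between; simpl.
        assert (RInt f a0 b0 <= RInt f a b) by (apply H1; lra).
        assert (RInt f a b <= l) by (apply H2; lra). lra.
  - exfalso. assert (l <= l - eps); [| destruct eps; simpl in *; lra].
    apply Hlub; intros y (a & b & Ha & Hab & ->).
    apply Rnot_lt_le; intros H; apply Hno; now exists a, b.
Qed.

Definition euler_integrand (s t : R) : R := Rpower t (s - 1) * exp (- t).

Lemma euler_integrand_exp (s t : R) :
  euler_integrand s t = exp ((s - 1) * ln t - t).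
Proof. unfold euler_integrand, Rpower; rewrite <- exp_plus; f_equal; ring. Qed.

Lemma euler_integrand_pos (s t : R) : 0 < euler_integrand s t.
Proof. rewrite euler_integrand_exp; apply exp_pos. Qed.

Lemma is_derive_euler_integrand (s t : R) : 0 < t ->
  is_derive (euler_integrand (s + 1)) t
    (s * euler_integrand s t - euler_integrand (s + 1) t).
Proof.
  intros Ht.
  apply (is_derive_ext (fun t => exp (s * ln t - t))).
  { intros y; rewrite euler_integrand_exp; do 2 f_equal; ring. }
  rewrite !euler_integrand_exp.
  auto_derive; [exact Ht |].
  replace ((s + 1 - 1) * ln t - t) with (s * ln t - t) by ring.
  (* t^(s-1) is rewritten as t^s / t *)
  replace ((s - 1) * ln t - t) with (s * ln t - t + - ln t) by ring.
  rewrite (exp_plus (s * ln t - t)), exp_Ropp, exp_ln by exact Ht.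
  unfold Rminus; field; lra.
Qed.

Lemma continuous_euler_integrand (s t : R) :
  0 < t -> continuous (euler_integrand s) t.
Proof.
  intros Ht; apply (ex_derive_continuous (euler_integrand s)).
  assert (H := is_derive_euler_integrand (s - 1) t Ht).
  replace (s - 1 + 1) with s in H by ring.
  eexists; exact H.
Qed.

Lemma ln_le_minus_one (y : R) : 0 < y -> ln y <= y - 1.
Proof.
  intros Hy; assert (H := exp_ineq1_le (ln y)).
  rewrite exp_ln in H by exact Hy; lra.
Qed.

(** Half of the exponential decay absorbs the power of [t]; the other half
    still makes the integral converge. *)
Lemma euler_integrand_le_exp (s : R) : 1 <= s ->
  exists C, 0 < C /\
    forall t, 0 < t -> euler_integrand s t <= C * exp (- t / 2).
Proof.
  intros Hs; set (q := 2 * s).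
  exists (exp ((s - 1) * ln q)); split; [apply exp_pos |].
  intros t Ht; rewrite euler_integrand_exp, <- exp_plus.
  (* ln t <= t / q + ln q, and (s - 1) / q <= 1 / 2 *)
  assert (Hq : 0 < q) by (unfold q; lra).
  assert (Hl : ln t <= t / q + ln q).
  { replace t with (t / q * q) at 1 by (field; lra).
    assert (0 < t / q) by (apply Rdiv_lt_0_compat; lra).
    rewrite ln_mult by assumption.
    assert (ln (t / q) <= t / q - 1) by now apply ln_le_minus_one.
    lra. }
  assert (Hh : (s - 1) * (t / q) <= t / 2).
  { apply Rmult_le_reg_r with q; [exact Hq |].
    replace ((s - 1) * (t / q) * q) with ((s - 1) * t) by (field; lra).
    unfold q; nra. }
  assert (Hm : (s - 1) * ln t <= (s - 1) * (t / q + ln q))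
    by (apply Rmult_le_compat_l; lra).
  assert (Hexp : (s - 1) * ln t - t <= (s - 1) * ln q + - t / 2) by lra.
  destruct (Rle_lt_or_eq_dec _ _ Hexp) as [H | H];
    [left; now apply exp_increasing | right; now rewrite H].
Qed.

Lemma Gamma_converges_pos (s : R) : 1 <= s ->
  is_RInt_gen (euler_integrand s) (at_right 0) (Rbar_locally p_infty) (Gamma s)
  /\ 0 < Gamma s.
Proof.
  intros Hs.
  destruct (euler_integrand_le_exp s Hs) as (C & HC & Hle).
  assert (Hc := continuous_euler_integrand s).
  assert (Hp : forall t, 0 < t -> 0 <= euler_integrand s t)
    by (intros; left; apply euler_integrand_pos).
  destruct (is_RInt_gen_nonneg_bounded (euler_integrand s) (2 * C)) as (l & Hl & Hub);
    [exact Hc | exact Hp | |].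
  { intros a b Ha Hab.
    assert (Hprim : is_RInt (fun t => C * exp (- t / 2)) a b
              (minus (-2 * C * exp (- b / 2)) (-2 * C * exp (- a / 2)))).
    { apply (is_RInt_derive (fun t => -2 * C * exp (- t / 2))).
      - intros t _; auto_derive; [exact I |]. unfold Rdiv; field.
      - intros t _; apply (ex_derive_continuous (fun t => C * exp (- t / 2))).
        now auto_derive. }
    apply Rle_trans with (RInt (fun t => C * exp (- t / 2)) a b).
    - apply RInt_le; [exact Hab | apply ex_RInt_pos; auto; lra | eexists; exact Hprim |].
      intros t Ht; apply Hle; lra.
    - rewrite (is_RInt_unique _ _ _ _ Hprim).
      unfold minus, plus, opp; simpl.
      assert (exp (- a / 2) < 1)
        by (rewrite <- exp_0; apply exp_increasing; lra).
      assert (0 < exp (- b / 2)) by apply exp_pos.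
      nra. }
  assert (HG : Gamma s = l) by now apply is_RInt_gen_unique.
  rewrite HG; split; [exact Hl |].
  apply Rlt_le_trans with (RInt (euler_integrand s) 1 2).
  - apply RInt_gt_0; [lra | intros; apply euler_integrand_pos |].
    intros; apply Hc; lra.
  - apply Hub; lra.
Qed.

Lemma Gamma_pos (s : R) : 1 <= s -> 0 < Gamma s.
Proof. intros Hs; apply (Gamma_converges_pos s Hs). Qed.

Lemma euler_integrand_vanishes_at_0 (s : R) : 1 <= s ->
  filterlim (euler_integrand (s + 1)) (at_right 0) (locally 0).
Proof.
  intros Hs P [eps HP].
  assert (Hm : 0 < Rmin 1 eps) by (apply Rmin_glb_lt; [lra | apply cond_pos]).
  exists (mkposreal _ Hm); intros t Ht Ht0; apply HP.
  apply ball_between in Ht; simpl in Ht; apply ball_between.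
  assert (H1 := Rmin_l 1 eps); assert (H2 := Rmin_r 1 eps).
  assert (H3 := euler_integrand_pos (s + 1) t).
  (* t^s exp (-t) <= t, since t < 1 <= s *)
  assert (H4 : euler_integrand (s + 1) t <= t).
  { rewrite euler_integrand_exp.
    rewrite <- (exp_ln t) at 3 by exact Ht0.
    left; apply exp_increasing.
    assert (ln t < 0) by (rewrite <- ln_1; apply ln_increasing; lra).
    nra. }
  lra.
Qed.

Lemma euler_integrand_vanishes_at_infinity (s : R) : 1 <= s ->
  filterlim (euler_integrand s) (Rbar_locally p_infty) (locally 0).
Proof.
  intros Hs P [eps HP].
  destruct (euler_integrand_le_exp s Hs) as (C & HC & Hle).
  assert (He := cond_pos eps).
  exists (2 * C / eps); intros t Ht; apply HP.
  assert (Ht0 : 0 < t).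
  { apply Rlt_trans with (2 := Ht); apply Rdiv_lt_0_compat; lra. }
  apply ball_between.
  assert (H1 := euler_integrand_pos s t).
  assert (H2 := Hle t Ht0).
  assert (H3 : exp (- t / 2) * exp (t / 2) = 1)
    by (rewrite <- exp_plus, <- exp_0; f_equal; field).
  assert (H4 := exp_ineq1_le (t / 2)).
  assert (H5 := exp_pos (- t / 2)).
  assert (H6 : 2 * C < eps * t).
  { apply Rmult_lt_compat_r with (r := eps) in Ht; [| lra].
    replace (2 * C / eps * eps) with (2 * C) in Ht by (field; lra). lra. }
  (* C < eps (t/2) < eps exp (t/2); now multiply by exp (-t/2) *)
  assert (C * exp (- t / 2) < eps * exp (t / 2) * exp (- t / 2)).
  { apply Rmult_lt_compat_r; nra. }
  nra.
Qed.

(** Integration by parts: the integral of the derivative of [t^s exp (-t)]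
    over the half-line is zero. *)
Lemma Gamma_succ (s : R) : 1 <= s -> Gamma (s + 1) = s * Gamma s.
Proof.
  intros Hs.
  destruct (Gamma_converges_pos s Hs) as [G0 _].
  destruct (Gamma_converges_pos (s + 1)) as [G1 _]; [lra |].
  pose (h := fun t => minus (scal s (euler_integrand s t)) (euler_integrand (s + 1) t) : R).
  assert (HD : forall t, 0 < t -> is_derive (euler_integrand (s + 1)) t (h t)).
  { intros t Ht; exact (is_derive_euler_integrand s t Ht). }
  assert (I1 : is_RInt_gen h (at_right 0) (Rbar_locally p_infty) (0 - 0)).
  { apply (is_RInt_gen_ext (Derive (euler_integrand (s + 1)))).
    - apply filter_imp with (2 := improper_domain (fun t => 0 < t) (fun t Ht => Ht)).
      intros ab Hab t Ht; apply is_derive_unique, HD, Hab; lra.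
    - apply is_RInt_gen_Derive.
      + apply improper_domain; intros t Ht; eexists; now apply HD.
      + apply improper_domain; intros t Ht.
        apply (continuous_ext_loc _ h).
        * exists (mkposreal t Ht); intros y Hy; symmetry.
          apply is_derive_unique, HD.
          apply ball_between in Hy; simpl in Hy; lra.
        * apply (continuous_minus (V := R_NormedModule)).
          -- apply (continuous_scal_r (V := R_NormedModule)).
             now apply continuous_euler_integrand.
          -- now apply continuous_euler_integrand.
      + now apply euler_integrand_vanishes_at_0.
      + apply euler_integrand_vanishes_at_infinity; lra. }
  assert (I2 : is_RInt_gen h (at_right 0) (Rbar_locally p_infty)
                 (minus (scal s (Gamma s)) (Gamma (s + 1)))).
  { apply (is_RInt_gen_minus (V := R_NormedModule)); [| exact G1].
    now apply (is_RInt_gen_scal (V := R_NormedModule)). }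
  apply (is_RInt_gen_unique (V := R_CompleteNormedModule)) in I1.
  apply (is_RInt_gen_unique (V := R_CompleteNormedModule)) in I2.
  rewrite I1 in I2; unfold minus, plus, opp, scal in I2; simpl in I2;
    unfold mult in I2; simpl in I2; lra.
Qed.

Lemma exp_convex (l u v : R) : 0 <= l <= 1 ->
  exp (l * u + (1 - l) * v) <= l * exp u + (1 - l) * exp v.
Proof.
  intros Hl; set (m := l * u + (1 - l) * v).
  (* both exponentials lie above the tangent line at m *)
  assert (H : forall w, exp m * (1 + (w - m)) <= exp w).
  { intros w; replace w with (m + (w - m)) at 2 by ring; rewrite exp_plus.
    apply Rmult_le_compat_l; [left; apply exp_pos | apply exp_ineq1_le]. }
  apply Rle_trans with
    (l * (exp m * (1 + (u - m))) + (1 - l) * (exp m * (1 + (v - m)))).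
  - right; unfold m; ring.
  - apply Rplus_le_compat; apply Rmult_le_compat_l; auto; lra.
Qed.

(** Hölder's inequality, in the form of the pointwise convexity of [exp]
    applied to the two integrands normalised to have integral one. *)
Lemma ln_Gamma_convex (l x y : R) : 0 <= l <= 1 -> 1 <= x -> 1 <= y ->
  ln (Gamma (l * x + (1 - l) * y)) <= l * ln (Gamma x) + (1 - l) * ln (Gamma y).
Proof.
  intros Hl Hx Hy; set (z := l * x + (1 - l) * y).
  assert (Hz : 1 <= z) by (unfold z; nra).
  destruct (Gamma_converges_pos x Hx) as [Gx Px].
  destruct (Gamma_converges_pos y Hy) as [Gy Py].
  destruct (Gamma_converges_pos z Hz) as [Gz Pz].
  set (m := l * ln (Gamma x) + (1 - l) * ln (Gamma y)).
  assert (HN : norm (scal (exp (- m)) (Gamma z)) <= 1).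
  { apply (RInt_gen_norm (V := R_CompleteNormedModule)
             (fun t => scal (exp (- m)) (euler_integrand z t))
             (fun t => plus (scal (l / Gamma x) (euler_integrand x t))
                            (scal ((1 - l) / Gamma y) (euler_integrand y t)))
             (Fa := at_right 0) (Fb := Rbar_locally p_infty)).
    - apply (Filter_prod _ _ _ (fun a => a < 1) (fun b => 1 < b)).
      + exists (mkposreal 1 Rlt_0_1); intros t Ht _.
        apply ball_between in Ht; simpl in Ht; lra.
      + now exists 1.
      + simpl; intros; lra.
    - apply filter_imp with (2 := improper_domain (fun t => 0 < t) (fun t Ht => Ht)).
      intros [a b] Hab t Ht; simpl in *.
      assert (Ht0 : 0 < t).
      { apply Hab. rewrite Rmin_left, Rmax_right; lra. }
      unfold norm, plus, scal; simpl; unfold mult, abs; simpl.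
      rewrite Rabs_pos_eq.
      2: { left; apply Rmult_lt_0_compat; [apply exp_pos | apply euler_integrand_pos]. }
      assert (H := exp_convex l ((x - 1) * ln t - t - ln (Gamma x))
                     ((y - 1) * ln t - t - ln (Gamma y)) Hl).
      rewrite !euler_integrand_exp, <- exp_plus.
      replace (- m + ((z - 1) * ln t - t)) with
        (l * ((x - 1) * ln t - t - ln (Gamma x))
          + (1 - l) * ((y - 1) * ln t - t - ln (Gamma y)))
        by (unfold m, z; ring).
      apply Rle_trans with (1 := H); right.
      assert (Hdiv : forall w c, 0 < c -> exp (w - ln c) = exp w / c).
      { intros w c Hc; unfold Rminus at 1.
        now rewrite exp_plus, exp_Ropp, exp_ln. }
      rewrite !Hdiv by assumption; unfold Rdiv; ring.
    - now apply (is_RInt_gen_scal (V := R_NormedModule)).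
    - replace 1 with (plus (scal (l / Gamma x) (Gamma x))
                           (scal ((1 - l) / Gamma y) (Gamma y))) at 1.
      2: { unfold plus, scal; simpl; unfold mult; simpl; field; lra. }
      apply (is_RInt_gen_plus (V := R_NormedModule));
        now apply (is_RInt_gen_scal (V := R_NormedModule)). }
  unfold norm, scal in HN; simpl in HN; unfold mult, abs in HN; simpl in HN.
  rewrite Rabs_pos_eq in HN
    by (left; apply Rmult_lt_0_compat; [apply exp_pos | exact Pz]).
  rewrite <- (exp_ln (Gamma z)), <- exp_plus in HN by exact Pz.
  apply Rnot_lt_le; intros Hlt.
  assert (exp 0 < exp (- m + ln (Gamma z))) by (apply exp_increasing; lra).
  rewrite exp_0 in H; lra.
Qed.

Lemma ln_Gamma_succ (x : R) : 1 <= x ->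
  ln (Gamma (x + 1)) = ln (Gamma x) + ln x.
Proof.
  intros Hx; rewrite Gamma_succ by exact Hx.
  rewrite ln_mult; [ring | lra | now apply Gamma_pos].
Qed.

(** * Convex solutions of the difference equation g (x + 1) - g x = ln x *)

Fixpoint psum (u : nat -> R) (n : nat) : R :=
  match n with O => 0 | S m => psum u m + u m end.

Lemma psum_le (u v : nat -> R) (n : nat) :
  (forall k, u k <= v k) -> psum u n <= psum v n.
Proof.
  intros H; induction n as [| n IH]; simpl; [lra |]. specialize (H n); lra.
Qed.

Lemma psum_nonneg (u : nat -> R) (n : nat) :
  (forall k, 0 <= u k) -> 0 <= psum u n.
Proof.
  intros H; induction n as [| n IH]; simpl; [lra |]. specialize (H n); lra.
Qed.

Lemma psum_scal (c : R) (u : nat -> R) (n : nat) :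
  psum (fun k => c * u k) n = c * psum u n.
Proof. induction n as [| n IH]; simpl; [| rewrite IH]; ring. Qed.

Lemma psum_minus (u v : nat -> R) (n : nat) :
  psum (fun k => u k - v k) n = psum u n - psum v n.
Proof. induction n as [| n IH]; simpl; [| rewrite IH]; ring. Qed.

Lemma psum_telescope (v : nat -> R) (n : nat) :
  psum (fun k => v k - v (S k)) n = v 0%nat - v n.
Proof. induction n as [| n IH]; simpl; [| rewrite IH]; ring. Qed.

Lemma Rabs_psum_le (u v : nat -> R) (n : nat) :
  (forall k, Rabs (u k) <= v k) -> Rabs (psum u n) <= psum v n.
Proof.
  intros H; induction n as [| n IH]; simpl; [rewrite Rabs_R0; lra |].
  apply Rle_trans with (1 := Rabs_triang _ _). specialize (H n); lra.
Qed.

Lemma ln_diff_le (a b : R) : 0 < a -> 0 < b -> ln a - ln b <= (a - b) / b.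
Proof.
  intros Ha Hb.
  assert (H := ln_le_minus_one (a / b) (Rdiv_lt_0_compat _ _ Ha Hb)).
  rewrite ln_div in H by assumption.
  replace ((a - b) / b) with (a / b - 1) by (field; lra). exact H.
Qed.

(** These two properties, which characterise [ln Gamma] up to a constant, are
    all that the computation of the derivatives uses. *)
Definition bohr_mollerup (g : R -> R) : Prop :=
  (forall l x y, 0 <= l <= 1 -> 1 <= x -> 1 <= y ->
     g (l * x + (1 - l) * y) <= l * g x + (1 - l) * g y)
  /\ (forall x, 1 <= x -> g (x + 1) = g x + ln x).

Lemma bohr_mollerup_ln_Gamma : bohr_mollerup (fun x => ln (Gamma x)).
Proof. split; [exact ln_Gamma_convex | exact ln_Gamma_succ]. Qed.

(** Convexity squeezes the chord from [y] to [y + h] between the chords over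
    [[y - 1, y]] and [[y, y + 1]], whose slopes the difference equation gives. *)
Lemma bohr_mollerup_chord (g : R -> R) (y h : R) :
  bohr_mollerup g -> 2 <= y -> -1 <= h <= 1 ->
  exists s, ln (y - 1) <= s <= ln y /\ g (y + h) - g y = s * h.
Proof.
  intros [Hconv Hstep] Hy Hh.
  assert (E1 : g (y + 1) = g y + ln y) by (apply Hstep; lra).
  assert (E0 : g y = g (y - 1) + ln (y - 1)).
  { rewrite <- Hstep by lra; f_equal; ring. }
  destruct (Rtotal_order h 0) as [Hneg | [-> | Hpos]].
  (* y + h lies in [y - 1, y], and y lies in [y + h, y + 1] *)
  - assert (H1 := Hconv (- h) (y - 1) y).
    replace (- h * (y - 1) + (1 - - h) * y) with (y + h) in H1 by ring.
    assert (H2 := Hconv (/ (1 - h)) (y + h) (y + 1)).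
    replace (/ (1 - h) * (y + h) + (1 - / (1 - h)) * (y + 1)) with y in H2
      by (field; lra).
    assert (Hi : 0 <= / (1 - h) <= 1).
    { split; [left; apply Rinv_0_lt_compat; lra |].
      rewrite <- Rinv_1; apply Rinv_le_contravar; lra. }
    assert (H3 : (1 - h) * g y <= g (y + h) - h * g (y + 1)).
    { replace (g (y + h) - h * g (y + 1)) with
        ((1 - h) * (/ (1 - h) * g (y + h) + (1 - / (1 - h)) * g (y + 1)))
        by (field; lra).
      apply Rmult_le_compat_l; [lra | apply H2; lra]. }
    assert (H4 : g (y + h) <= - h * g (y - 1) + (1 - - h) * g y)
      by (apply H1; lra).
    exists ((g (y + h) - g y) / h); split; [| field; lra].
    rewrite E1 in H3.
    split; apply Rmult_le_reg_l with (- h); try lra;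
      replace (- h * ((g (y + h) - g y) / h)) with (g y - g (y + h))
        by (field; lra); nra.
  - exists (ln y); split; [split; [apply ln_le; lra | lra] |].
    rewrite Rplus_0_r; ring.
  (* y + h lies in [y, y + 1], and y lies in [y - 1, y + h] *)
  - assert (H1 := Hconv h (y + 1) y).
    replace (h * (y + 1) + (1 - h) * y) with (y + h) in H1 by ring.
    assert (H2 := Hconv (/ (1 + h)) (y + h) (y - 1)).
    replace (/ (1 + h) * (y + h) + (1 - / (1 + h)) * (y - 1)) with y in H2
      by (field; lra).
    assert (Hi : 0 <= / (1 + h) <= 1).
    { split; [left; apply Rinv_0_lt_compat; lra |].
      rewrite <- Rinv_1; apply Rinv_le_contravar; lra. }
    assert (H3 : (1 + h) * g y <= g (y + h) + h * g (y - 1)).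
    { replace (g (y + h) + h * g (y - 1)) with
        ((1 + h) * (/ (1 + h) * g (y + h) + (1 - / (1 + h)) * g (y - 1)))
        by (field; lra).
      apply Rmult_le_compat_l; [lra | apply H2; lra]. }
    assert (H4 : g (y + h) <= h * g (y + 1) + (1 - h) * g y)
      by (apply H1; lra).
    exists ((g (y + h) - g y) / h); split; [| field; lra].
    rewrite E1 in H4.
    split; apply Rmult_le_reg_l with h; try lra;
      replace (h * ((g (y + h) - g y) / h)) with (g (y + h) - g y)
        by (field; lra); nra.
Qed.

Lemma bohr_mollerup_shift (g : R -> R) (x : R) (n : nat) :
  bohr_mollerup g -> 1 <= x ->
  g (x + INR n) = g x + psum (fun k => ln (x + INR k)) n.
Proof.
  intros [_ Hstep] Hx; induction n as [| n IH].
  - simpl; rewrite Rplus_0_r; ring.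
  - rewrite S_INR, <- Rplus_assoc, Hstep, IH; [simpl; ring |].
    assert (H := pos_INR n); lra.
Qed.

Lemma is_derive_psum_ln (x : R) (n : nat) : 0 < x ->
  is_derive (fun z => psum (fun k => ln (z + INR k)) n) x
    (psum (fun k => / (x + INR k)) n).
Proof.
  intros Hx; induction n as [| n IH]; simpl; [apply @is_derive_const |].
  apply (is_derive_plus (V := R_NormedModule)); [exact IH |].
  assert (H := pos_INR n).
  auto_derive; [lra | field; lra].
Qed.

Definition digamma_upper (x : R) (n : nat) : R :=
  ln (x + INR n) - psum (fun k => / (x + INR k)) n.

Definition digamma_lower (x : R) (n : nat) : R :=
  ln (x + INR n - 1) - psum (fun k => / (x + INR k)) n.

(** Both sequences are monotone because [1 / y] lies between the logarithmic
    increments over [[y, y + 1]] and [[y - 1, y]]. *)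
Lemma digamma_bracket (x : R) : 1 < x ->
  exists D : R, is_lim_seq (digamma_upper x) D
    /\ forall n, digamma_lower x n <= D <= digamma_upper x n.
Proof.
  intros Hx.
  assert (Hn : forall n, 1 < x + INR n)
    by (intros n; assert (H := pos_INR n); lra).
  assert (Hup : forall n, digamma_upper x (S n) <= digamma_upper x n).
  { intros n; unfold digamma_upper; rewrite S_INR; simpl; specialize (Hn n).
    assert (H : ln (x + INR n + 1) - ln (x + INR n)
              <= (x + INR n + 1 - (x + INR n)) / (x + INR n))
      by (apply ln_diff_le; lra).
    replace ((x + INR n + 1 - (x + INR n)) / (x + INR n)) with (/ (x + INR n))
      in H by (field; lra).
    replace (x + (INR n + 1)) with (x + INR n + 1) by ring; lra. }
  assert (Hlo : forall n, digamma_lower x n <= digamma_lower x (S n)).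
  { intros n; unfold digamma_lower; rewrite S_INR; simpl; specialize (Hn n).
    assert (H : ln (x + INR n - 1) - ln (x + INR n)
              <= (x + INR n - 1 - (x + INR n)) / (x + INR n))
      by (apply ln_diff_le; lra).
    replace ((x + INR n - 1 - (x + INR n)) / (x + INR n)) with (- / (x + INR n))
      in H by (field; lra).
    replace (x + (INR n + 1) - 1) with (x + INR n) by ring; lra. }
  assert (Hlu : forall n, digamma_lower x n <= digamma_upper x n).
  { intros n; unfold digamma_lower, digamma_upper; specialize (Hn n).
    assert (ln (x + INR n - 1) <= ln (x + INR n)) by (apply ln_le; lra). lra. }
  assert (Hup' : forall n m, (n <= m)%nat -> digamma_upper x m <= digamma_upper x n)
    by (intros n m H; induction H as [| m H IH]; [lra | specialize (Hup m); lra]).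
  assert (Hlo' : forall n m, (n <= m)%nat -> digamma_lower x n <= digamma_lower x m)
    by (intros n m H; induction H as [| m H IH]; [lra | specialize (Hlo m); lra]).
  assert (Hcross : forall n m, digamma_lower x n <= digamma_upper x m).
  { intros n m.
    apply Rle_trans with (1 := Hlo' n _ (Nat.le_max_l n m)).
    apply Rle_trans with (2 := Hup' m _ (Nat.le_max_r n m)). apply Hlu. }
  destruct (ex_finite_lim_seq_decr (digamma_upper x) (digamma_lower x 0) Hup)
    as [D HD]; [intros n; apply Hcross |].
  exists D; split; [exact HD |]; intros n; split.
  - exact (is_lim_seq_le _ _ (digamma_lower x n) D (Hcross n)
             (is_lim_seq_const _) HD).
  - apply (is_lim_seq_le_loc (digamma_upper x) (fun _ => digamma_upper x n) D
             (digamma_upper x n)); [| exact HD | apply is_lim_seq_const].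
    exists n; intros m Hm; now apply Hup'.
Qed.

(** After [n] steps of the difference equation the chord slope of [g] at [x] is
    an explicit smooth term plus a chord slope at [x + n], which is known up to
    [ln (x + n) - ln (x + n - 1)]. *)
Lemma bohr_mollerup_derive (g : R -> R) (x : R) :
  bohr_mollerup g -> 1 < x ->
  exists D : R, is_derive g x D /\ is_lim_seq (digamma_upper x) D.
Proof.
  intros Hg Hx.
  destruct (digamma_bracket x Hx) as (D & Hlim & Hbr).
  exists D; split; [| exact Hlim].
  apply is_derive_Reals; intros eps Heps.
  (* n is large enough for the slope at x + n to be known within eps / 2 *)
  destruct (INR_unbounded (2 / eps + 1)) as [n Hn].
  assert (H2e : 0 < 2 / eps) by (apply Rdiv_lt_0_compat; lra).
  assert (Hgap : ln (x + INR n) - ln (x + INR n - 1) < eps / 2).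
  { apply Rle_lt_trans with ((x + INR n - (x + INR n - 1)) / (x + INR n - 1)).
    - apply ln_diff_le; lra.
    - apply Rmult_lt_reg_r with (x + INR n - 1); [lra |].
      replace ((x + INR n - (x + INR n - 1)) / (x + INR n - 1) * (x + INR n - 1))
        with 1 by (field; lra).
      replace 1 with (eps / 2 * (2 / eps)) at 1 by (field; lra).
      apply Rmult_lt_compat_l; lra. }
  assert (HG := is_derive_psum_ln x n ltac:(lra)).
  apply is_derive_Reals in HG.
  destruct (HG (eps / 2) ltac:(lra)) as [d Hd].
  assert (Hm : 0 < Rmin d (Rmin 1 (x - 1))).
  { repeat apply Rmin_glb_lt; try lra; apply cond_pos. }
  exists (mkposreal _ Hm); intros h Hh0 Hh; simpl in Hh.
  assert (Hhd : Rabs h < d) by (apply Rlt_le_trans with (1 := Hh); apply Rmin_l).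
  assert (Hh' := Rlt_le_trans _ _ _ Hh (Rmin_r _ _)).
  assert (Hh1 : Rabs h < 1) by (apply Rlt_le_trans with (1 := Hh'); apply Rmin_l).
  assert (Hhx : Rabs h < x - 1)
    by (apply Rlt_le_trans with (1 := Hh'); apply Rmin_r).
  apply Rabs_lt_between in Hh1; apply Rabs_lt_between in Hhx.
  specialize (Hd h Hh0 Hhd).
  assert (Hx1 : 1 <= x + INR n - 1) by lra.
  destruct (bohr_mollerup_chord g (x + INR n) h Hg) as (s & Hs & Es); [lra | lra |].
  assert (Eh := bohr_mollerup_shift g (x + h) n Hg ltac:(lra)).
  assert (E0 := bohr_mollerup_shift g x n Hg ltac:(lra)).
  replace (x + INR n + h) with (x + h + INR n) in Es by ring.
  specialize (Hbr n); unfold digamma_lower, digamma_upper in Hbr.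
  set (G := fun z => psum (fun k => ln (z + INR k)) n) in *.
  set (P := psum (fun k => / (x + INR k)) n) in *.
  change (psum (fun k => ln (x + h + INR k)) n) with (G (x + h)) in Eh.
  change (psum (fun k => ln (x + INR k)) n) with (G x) in E0.
  replace ((g (x + h) - g x) / h - D) with ((s - (D + P)) - ((G (x + h) - G x) / h - P)).
  2: { replace (g (x + h) - g x) with (s * h - (G (x + h) - G x)) by lra.
       field; exact Hh0. }
  change (Rabs ((G (x + h) - G x) / h - P) < eps / 2) in Hd.
  apply Rabs_lt_between in Hd; apply Rabs_lt_between. lra.
Qed.

Lemma digamma_is_limit (x : R) : 1 < x ->
  is_lim_seq (digamma_upper x) (digamma x).
Proof.
  intros Hx.
  destruct (bohr_mollerup_derive _ x bohr_mollerup_ln_Gamma Hx) as (D & HD & Hlim).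
  now replace (digamma x) with D by (symmetry; apply is_derive_unique, HD).
Qed.

(** * The trigamma function as a series *)

Lemma trigamma_series_converges (x : R) : 1 < x ->
  ex_finite_lim_seq (psum (fun k => / (x + INR k) ^ 2)).
Proof.
  intros Hx.
  assert (Hk : forall k, 1 < x + INR k)
    by (intros k; assert (H := pos_INR k); lra).
  apply ex_finite_lim_seq_incr with (/ (x - 1)).
  - intros n; specialize (Hk n).
    assert (0 < / (x + INR n) ^ 2) by (apply Rinv_0_lt_compat, pow_lt; lra).
    cbn [psum]; lra.
  (* 1 / y^2 <= 1 / (y - 1) - 1 / y telescopes *)
  - intros n.
    apply Rle_trans with
      (psum (fun k => / (x - 1 + INR k) - / (x - 1 + INR (S k))) n).
    + apply psum_le; intros k; rewrite S_INR; specialize (Hk k).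
      set (y := x + INR k) in *.
      replace (x - 1 + INR k) with (y - 1) by (unfold y; ring).
      replace (x - 1 + (INR k + 1)) with y by (unfold y; ring).
      replace (/ (y - 1) - / y) with (/ ((y - 1) * y)) by (field; lra).
      apply Rinv_le_contravar; nra.
    + rewrite (psum_telescope (fun k => / (x - 1 + INR k))).
      simpl (INR 0); rewrite Rplus_0_r.
      assert (0 < / (x - 1 + INR n))
        by (specialize (Hk n); apply Rinv_0_lt_compat; lra).
      lra.
Qed.

(** A quantitative first-order expansion, uniform in [n], of the sequences whose
    limit is [digamma]. *)
Lemma digamma_upper_expansion (x h : R) (n : nat) : 1 < x -> 1 < x + h ->
  Rabs (digamma_upper (x + h) n - digamma_upper x n
        - h * psum (fun k => / (x + INR k) ^ 2) n)
  <= Rabs h * / INR (S n) + h ^ 2 * psum (fun k => / (x + INR k) ^ 2) n.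
Proof.
  intros Hx Hxh.
  assert (Hn := pos_INR n).
  unfold digamma_upper.
  replace (ln (x + h + INR n) - psum (fun k => / (x + h + INR k)) n
    - (ln (x + INR n) - psum (fun k => / (x + INR k)) n)
    - h * psum (fun k => / (x + INR k) ^ 2) n)
    with ((ln (x + h + INR n) - ln (x + INR n))
      + psum (fun k => / (x + INR k) - / (x + h + INR k)
                       - h * / (x + INR k) ^ 2) n)
    by (rewrite !psum_minus, psum_scal; ring).
  apply Rle_trans with (1 := Rabs_triang _ _).
  apply Rplus_le_compat.
  - assert (H1 := ln_diff_le (x + h + INR n) (x + INR n) ltac:(lra) ltac:(lra)).
    assert (H2 := ln_diff_le (x + INR n) (x + h + INR n) ltac:(lra) ltac:(lra)).
    replace (x + h + INR n - (x + INR n)) with h in H1 by ring.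
    replace (x + INR n - (x + h + INR n)) with (- h) in H2 by ring.
    assert (Hb : forall c y, INR (S n) <= y -> c / y <= Rabs c * / INR (S n)).
    { intros c y Hy; rewrite S_INR in *; unfold Rdiv.
      apply Rle_trans with (Rabs c * / y).
      - apply Rmult_le_compat_r; [left; apply Rinv_0_lt_compat; lra | apply Rle_abs].
      - apply Rmult_le_compat_l; [apply Rabs_pos | apply Rinv_le_contravar; lra]. }
    assert (H3 := Hb h (x + INR n) ltac:(rewrite S_INR; lra)).
    assert (H4 := Hb (- h) (x + h + INR n) ltac:(rewrite S_INR; lra)).
    rewrite Rabs_Ropp in H4.
    apply Rabs_le_between; lra.
  - rewrite <- psum_scal.
    apply Rabs_psum_le; intros k.
    assert (Hk := pos_INR k).
    replace (/ (x + INR k) - / (x + h + INR k) - h * / (x + INR k) ^ 2)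
      with (- (h ^ 2 * / (x + INR k) ^ 2 * / (x + h + INR k)))
      by (field; lra).
    rewrite Rabs_Ropp.
    assert (H0 : 0 <= h ^ 2 * / (x + INR k) ^ 2).
    { apply Rmult_le_pos; [apply pow2_ge_0 |].
      left; apply Rinv_0_lt_compat, pow_lt; lra. }
    assert (H1 : 0 < / (x + h + INR k) <= 1).
    { split; [apply Rinv_0_lt_compat; lra |].
      rewrite <- Rinv_1; apply Rinv_le_contravar; lra. }
    rewrite Rabs_pos_eq by (apply Rmult_le_pos; lra).
    rewrite <- (Rmult_1_r (h ^ 2 * / (x + INR k) ^ 2)) at 2.
    apply Rmult_le_compat_l; lra.
Qed.

Lemma is_lim_seq_inv_INR_S : is_lim_seq (fun n => / INR (S n)) 0.
Proof.
  apply (is_lim_seq_incr_1 (fun n => / INR n)).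
  apply (is_lim_seq_inv _ p_infty); [apply is_lim_seq_INR | discriminate].
Qed.

(** In the limit the expansion reads
    [|digamma (x + h) - digamma x - h T| <= h ^ 2 T], where [T] is the sum of the
    series; so [T] is the derivative. *)
Lemma trigamma_is_series (x : R) : 1 < x ->
  is_lim_seq (psum (fun k => / (x + INR k) ^ 2)) (trigamma x).
Proof.
  intros Hx.
  destruct (trigamma_series_converges x Hx) as [T HT].
  replace (trigamma x) with T; [exact HT |].
  symmetry; apply is_derive_unique, is_derive_Reals.
  assert (HT0 : 0 <= T).
  { apply (is_lim_seq_le (fun _ => 0) (psum (fun k => / (x + INR k) ^ 2)) 0 T);
      [| apply is_lim_seq_const | exact HT].
    intros n; apply psum_nonneg; intros k; assert (H := pos_INR k).
    left; apply Rinv_0_lt_compat, pow_lt; lra. }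
  assert (Hquad : forall h, 1 < x + h ->
            Rabs (digamma (x + h) - digamma x - h * T) <= h ^ 2 * T).
  { intros h Hh.
    replace (h ^ 2 * T) with (Rabs h * 0 + h ^ 2 * T) by ring.
    apply (is_lim_seq_le _ _ (Rabs (digamma (x + h) - digamma x - h * T))
             (Rabs h * 0 + h ^ 2 * T)
             (fun n => digamma_upper_expansion x h n Hx Hh)).
    - apply (is_lim_seq_abs _ (digamma (x + h) - digamma x - h * T)).
      apply is_lim_seq_minus'; [apply is_lim_seq_minus' |].
      + now apply digamma_is_limit.
      + now apply digamma_is_limit.
      + apply (is_lim_seq_scal_l _ h T HT).
    - apply is_lim_seq_plus'.
      + apply (is_lim_seq_scal_l _ (Rabs h) 0), is_lim_seq_inv_INR_S.
      + apply (is_lim_seq_scal_l _ (h ^ 2) T HT). }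
  intros eps Heps.
  assert (Hm : 0 < Rmin (x - 1) (eps / (T + 1))).
  { apply Rmin_glb_lt; [lra | apply Rdiv_lt_0_compat; lra]. }
  exists (mkposreal _ Hm); intros h Hh0 Hh; simpl in Hh.
  assert (Hhx := Rlt_le_trans _ _ _ Hh (Rmin_l _ _)).
  assert (Hhe := Rlt_le_trans _ _ _ Hh (Rmin_r _ _)).
  apply Rabs_lt_between in Hhx.
  specialize (Hquad h ltac:(lra)).
  replace ((digamma (x + h) - digamma x) / h - T)
    with ((digamma (x + h) - digamma x - h * T) / h) by (field; exact Hh0).
  assert (Hp : 0 < Rabs h) by now apply Rabs_pos_lt.
  rewrite Rabs_div by exact Hh0.
  apply Rmult_lt_reg_r with (Rabs h); [exact Hp |].
  replace (Rabs (digamma (x + h) - digamma x - h * T) / Rabs h * Rabs h)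
    with (Rabs (digamma (x + h) - digamma x - h * T)) by (field; lra).
  apply Rle_lt_trans with (1 := Hquad).
  rewrite <- (pow2_abs h).
  apply Rmult_lt_compat_r with (r := T + 1) in Hhe; [| lra].
  replace (eps / (T + 1) * (T + 1)) with eps in Hhe by (field; lra).
  nra.
Qed.


(** * Telescoping bounds for the trigamma function *)

(** [trigamma (x + 1)] is the sum of the [1 / (x + k + 1) ^ 2], and [A x] is the
    sum of the decrements [A (x + k) - A (x + k + 1)]; a termwise comparison
    gives the bound. *)
Lemma trigamma_le_of_decrement (A : R -> R) (x : R) : 0 < x ->
  (forall y, x <= y -> / (y + 1) ^ 2 <= A y - A (y + 1)) ->
  is_lim_seq (fun n => A (x + INR n)) 0 ->
  trigamma (x + 1) <= A x.
Proof.
  intros Hx Hdec Hlim.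
  apply (is_lim_seq_le (psum (fun k => / (x + 1 + INR k) ^ 2))
           (fun n => A x - A (x + INR n)) (trigamma (x + 1)) (A x)).
  - intros n.
    apply Rle_trans with (psum (fun k => A (x + INR k) - A (x + INR (S k))) n).
    + apply psum_le; intros k; rewrite S_INR.
      replace (x + 1 + INR k) with (x + INR k + 1) by ring.
      replace (x + (INR k + 1)) with (x + INR k + 1) by ring.
      apply Hdec; assert (H := pos_INR k); lra.
    + rewrite (psum_telescope (fun k => A (x + INR k))).
      simpl (INR 0); rewrite Rplus_0_r; lra.
  - apply trigamma_is_series; lra.
  - replace (Finite (A x)) with (Finite (A x - 0)) by (f_equal; ring).
    apply is_lim_seq_minus'; [apply is_lim_seq_const | exact Hlim].
Qed.

Lemma trigamma_ge_of_decrement (A : R -> R) (x : R) : 0 < x ->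
  (forall y, x <= y -> A y - A (y + 1) <= / (y + 1) ^ 2) ->
  is_lim_seq (fun n => A (x + INR n)) 0 ->
  A x <= trigamma (x + 1).
Proof.
  intros Hx Hdec Hlim.
  apply (is_lim_seq_le (fun n => A x - A (x + INR n))
           (psum (fun k => / (x + 1 + INR k) ^ 2)) (A x) (trigamma (x + 1))).
  - intros n.
    apply Rle_trans with (psum (fun k => A (x + INR k) - A (x + INR (S k))) n).
    + rewrite (psum_telescope (fun k => A (x + INR k))).
      simpl (INR 0); rewrite Rplus_0_r; lra.
    + apply psum_le; intros k; rewrite S_INR.
      replace (x + 1 + INR k) with (x + INR k + 1) by ring.
      replace (x + (INR k + 1)) with (x + INR k + 1) by ring.
      apply Hdec; assert (H := pos_INR k); lra.
  - replace (Finite (A x)) with (Finite (A x - 0)) by (f_equal; ring).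
    apply is_lim_seq_minus'; [apply is_lim_seq_const | exact Hlim].
  - apply trigamma_is_series; lra.
Qed.

(** The vanishing at infinity that the telescoping bounds require, for functions
    that are polynomial in [1 / y]. *)
Lemma is_lim_seq_at_inv (p A : R -> R) (x : R) : 0 < x ->
  (forall y, 0 < y -> A y = p (/ y)) -> p 0 = 0 -> ex_derive p 0 ->
  is_lim_seq (fun n => A (x + INR n)) 0.
Proof.
  intros Hx HA Hp0 Hp.
  apply (is_lim_seq_ext (fun n => p (/ (x + INR n)))).
  { intros n; rewrite HA; [reflexivity | assert (H := pos_INR n); lra]. }
  rewrite <- Hp0.
  apply is_lim_seq_continuous.
  - now apply continuity_pt_filterlim, (ex_derive_continuous p).
  - apply (is_lim_seq_inv _ p_infty); [| discriminate].
    apply (is_lim_seq_plus _ _ x p_infty);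
      [apply is_lim_seq_const | apply is_lim_seq_INR | reflexivity].
Qed.

(** The asymptotic series of [trigamma (x + 1)], whose coefficients are the
    Bernoulli numbers, cut after the term in [1 / x ^ 7], then after the one in
    [1 / x ^ 9]. Consecutive truncations enclose the function. *)
Definition stirling7 (x : R) : R :=
  1 / x - 1 / (2 * x ^ 2) + 1 / (6 * x ^ 3) - 1 / (30 * x ^ 5) + 1 / (42 * x ^ 7).

Definition stirling9 (x : R) : R := stirling7 x - 1 / (30 * x ^ 9).

Ltac positivity :=
  first
    [ assumption | lra
    | apply Rplus_lt_0_compat; [positivity | positivity]
    | apply Rplus_le_lt_0_compat; [nonnegativity | positivity]
    | apply Rmult_lt_0_compat; [positivity | positivity]
    | apply pow_lt; positivity ]
with nonnegativity :=
  first
    [ assumption | lra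
    | apply Rplus_le_le_0_compat; [nonnegativity | nonnegativity]
    | apply Rmult_le_pos; [nonnegativity | nonnegativity]
    | apply pow_le; nonnegativity ].

(** Proves [e1 < e2] for rational functions of [x >= 1] whenever the difference
    [e2 - e1], written in [t = x - 1], is a quotient of two polynomials with
    nonnegative coefficients and positive constant terms. *)
Ltac rational_lt x Hx :=
  apply Rminus_lt_0;
  let t := fresh "t" in
  let Ht := fresh "Ht" in
  let E := fresh "E" in
  pose (t := x - 1);
  assert (Ht : 0 <= t) by (unfold t; lra);
  assert (E : x = t + 1) by (unfold t; ring);
  clearbody t; subst x; clear Hx;
  match goal with
  | |- 0 < ?d => field_simplify d; [ | lra .. ]
  end;
  apply Rdiv_lt_0_compat; positivity.

Lemma trigamma_le_stirling7 (x : R) : 1 <= x -> trigamma (x + 1) <= stirling7 x.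
Proof.
  intros Hx.
  apply trigamma_le_of_decrement; [lra | |].
  - intros y Hxy; assert (Hy : 1 <= y) by lra; clear x Hx Hxy.
    left; unfold stirling7; rational_lt y Hy.
  - apply (is_lim_seq_at_inv
      (fun u => u - u ^ 2 / 2 + u ^ 3 / 6 - u ^ 5 / 30 + u ^ 7 / 42)).
    + lra.
    + intros y Hy; unfold stirling7; field; lra.
    + field.
    + now auto_derive.
Qed.

Lemma stirling9_le_trigamma (x : R) : 1 <= x -> stirling9 x <= trigamma (x + 1).
Proof.
  intros Hx.
  apply trigamma_ge_of_decrement; [lra | |].
  - intros y Hxy; assert (Hy : 1 <= y) by lra; clear x Hx Hxy.
    left; unfold stirling9, stirling7; rational_lt y Hy.
  - apply (is_lim_seq_at_inv
      (fun u => u - u ^ 2 / 2 + u ^ 3 / 6 - u ^ 5 / 30 + u ^ 7 / 42 - u ^ 9 / 30)).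
    + lra.
    + intros y Hy; unfold stirling9, stirling7; field; lra.
    + field.
    + now auto_derive.
Qed.

(** * Taylor bounds for the exponential *)

Definition taylor_exp (n : nat) (u : R) : R :=
  psum (fun k => u ^ k / INR (fact k)) n.

Lemma taylor_exp_at_0 (n : nat) : taylor_exp (S n) 0 = 1.
Proof.
  induction n as [| n IH]; unfold taylor_exp in *; [simpl; field |].
  change (psum (fun k => 0 ^ k / INR (fact k)) (S n)
          + 0 ^ S n / INR (fact (S n)) = 1).
  rewrite IH, pow_i by lia; unfold Rdiv; ring.
Qed.

Lemma is_derive_pow_div_fact (n : nat) (u : R) :
  is_derive (fun u => u ^ S n / INR (fact (S n))) u (u ^ n / INR (fact n)).
Proof.
  assert (H1 := INR_fact_neq_0 n); assert (H2 := not_0_INR (S n) ltac:(lia)).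
  auto_derive; [exact I |].
  change (fact n + n * fact n)%nat with (fact (S n)).
  rewrite fact_simpl, mult_INR; simpl Nat.pred.
  change (match n with O => 1 | S _ => INR n + 1 end) with (INR (S n)).
  field; auto.
Qed.

Lemma is_derive_taylor_exp (n : nat) (u : R) :
  is_derive (taylor_exp (S n)) u (taylor_exp n u).
Proof.
  induction n as [| n IH].
  - apply (is_derive_ext (fun _ => 1)); [| apply @is_derive_const].
    intros y; unfold taylor_exp; simpl; field.
  - apply (is_derive_plus (V := R_NormedModule) (taylor_exp (S n))
             (fun u => u ^ S n / INR (fact (S n)))).
    + exact IH.
    + apply is_derive_pow_div_fact.
Qed.

Lemma nonneg_of_derivative_nonneg (f df : R -> R) (c : R) :
  (forall u, 0 <= u <= c -> is_derive f u (df u)) ->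
  (forall u, 0 <= u <= c -> 0 <= df u) ->
  0 <= f 0 -> forall u, 0 <= u <= c -> 0 <= f u.
Proof.
  intros Hd Hp H0 u Hu.
  destruct (MVT_gen f 0 u df) as (w & Hw & E).
  - rewrite Rmin_left, Rmax_right by lra; intros; apply Hd; lra.
  - rewrite Rmin_left, Rmax_right by lra; intros v Hv.
    apply continuity_pt_filterlim, (ex_derive_continuous f).
    eexists; apply Hd; lra.
  - rewrite Rmin_left, Rmax_right in Hw by lra.
    assert (0 <= df w) by (apply Hp; lra).
    assert (0 <= df w * (u - 0)) by (apply Rmult_le_pos; lra).
    lra.
Qed.

(** Differentiating lowers [n] by one, which makes this and the next two bounds
    inductions on [n] that integrate the previous bound from [0]. *)
Lemma taylor_exp_le_exp (n : nat) (u : R) : 0 <= u -> taylor_exp n u <= exp u.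
Proof.
  intros Hu; apply Rminus_le_0; revert u Hu.
  induction n as [| n IH]; intros u Hu.
  - unfold taylor_exp; simpl; left; assert (H := exp_pos u); lra.
  - apply (nonneg_of_derivative_nonneg
      (fun u => exp u - taylor_exp (S n) u) (fun u => exp u - taylor_exp n u) u).
    + intros v _; apply (is_derive_minus (V := R_NormedModule));
        [apply is_derive_exp | apply is_derive_taylor_exp].
    + intros v Hv; apply IH; lra.
    + rewrite taylor_exp_at_0, exp_0; lra.
    + lra.
Qed.

(** The constant 3 is a bound for [exp] on [[0, 1]], the case [n = 0]. *)
Lemma exp_le_taylor_exp (n : nat) (u : R) : 0 <= u <= 1 ->
  exp u <= taylor_exp n u + 3 * (u ^ n / INR (fact n)).
Proof.
  intros Hu; apply Rminus_le_0; revert u Hu.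
  induction n as [| n IH]; intros u Hu.
  - unfold taylor_exp; simpl.
    assert (exp u <= 3); [| lra].
    apply Rle_trans with (2 := exp_le_3).
    destruct (Rle_lt_or_eq_dec u 1) as [H | ->]; [lra | | lra].
    left; now apply exp_increasing.
  - apply (nonneg_of_derivative_nonneg
      (fun u => taylor_exp (S n) u + 3 * (u ^ S n / INR (fact (S n))) - exp u)
      (fun u => taylor_exp n u + 3 * (u ^ n / INR (fact n)) - exp u) 1).
    + intros v _; apply (is_derive_minus (V := R_NormedModule));
        [| apply is_derive_exp].
      apply (is_derive_plus (V := R_NormedModule));
        [apply is_derive_taylor_exp |].
      apply (is_derive_scal (fun u => u ^ S n / INR (fact (S n)))).
      apply is_derive_pow_div_fact.
    + exact IH.
    + rewrite taylor_exp_at_0, exp_0, pow_i by lia; unfold Rdiv; lra.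
    + exact Hu.
Qed.

(** Each differentiation in [v] changes the sign, so the bounds alternate. *)
Lemma taylor_exp_alternates (n : nat) (v : R) : 0 <= v ->
  0 <= (-1) ^ n * (exp (- v) - taylor_exp n (- v)).
Proof.
  revert v; induction n as [| n IH]; intros v Hv.
  - unfold taylor_exp; simpl; assert (H := exp_pos (- v)); lra.
  - apply (nonneg_of_derivative_nonneg
      (fun v => (-1) ^ S n * (exp (- v) - taylor_exp (S n) (- v)))
      (fun v => (-1) ^ n * (exp (- v) - taylor_exp n (- v))) v).
    + intros w _.
      replace ((-1) ^ n * (exp (- w) - taylor_exp n (- w))) with
        ((-1) ^ S n * (- exp (- w) - (-1) * taylor_exp n (- w)))
        by (simpl; ring).
      apply (is_derive_scal
        (fun v => exp (- v) - taylor_exp (S n) (- v))).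
      apply (is_derive_minus (V := R_NormedModule)).
      * auto_derive; [exact I | ring].
      * apply (is_derive_comp (V := R_NormedModule) (taylor_exp (S n)) Ropp).
        -- apply is_derive_taylor_exp.
        -- auto_derive; [exact I | ring].
    + intros w Hw; apply IH; lra.
    + rewrite Ropp_0, taylor_exp_at_0, exp_0; lra.
    + lra.
Qed.

(** [theta] increases with [exp (m / (x + 1))] and decreases with
    [exp (- m / x)]; an odd number of terms bounds the latter from above, an even
    number from below. *)
Lemma theta_lower (n p : nat) (x m : R) : 0 < x -> 0 < m ->
  (taylor_exp n (m / (x + 1)) - taylor_exp (2 * p + 1) (- (m / x))) / (2 * m)
  <= theta x m.
Proof.
  intros Hx Hm; unfold theta.
  apply Rmult_le_compat_r; [left; apply Rinv_0_lt_compat; lra |].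
  assert (H1 := taylor_exp_le_exp n (m / (x + 1))
    ltac:(left; apply Rdiv_lt_0_compat; lra)).
  assert (H2 := taylor_exp_alternates (2 * p + 1) (m / x)
    ltac:(left; apply Rdiv_lt_0_compat; lra)).
  rewrite Nat.add_1_r, pow_1_odd, <- Nat.add_1_r in H2; lra.
Qed.

Lemma theta_upper (n p : nat) (x m : R) : 0 < x -> 0 < m <= x + 1 ->
  theta x m <=
  (taylor_exp n (m / (x + 1)) + 3 * ((m / (x + 1)) ^ n / INR (fact n))
   - taylor_exp (2 * p) (- (m / x))) / (2 * m).
Proof.
  intros Hx Hm; unfold theta.
  apply Rmult_le_compat_r; [left; apply Rinv_0_lt_compat; lra |].
  assert (Hu : 0 <= m / (x + 1) <= 1).
  { split; [left; apply Rdiv_lt_0_compat; lra |].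
    apply Rmult_le_reg_r with (x + 1); [lra |].
    replace (m / (x + 1) * (x + 1)) with m by (field; lra); lra. }
  assert (H1 := exp_le_taylor_exp n (m / (x + 1)) Hu).
  assert (H2 := taylor_exp_alternates (2 * p) (m / x)
    ltac:(left; apply Rdiv_lt_0_compat; lra)).
  rewrite pow_1_even in H2; lra.
Qed.

Ltac expand_taylor :=
  unfold taylor_exp; cbn [psum];
  rewrite ?fact_simpl, ?mult_INR; cbn [fact INR].

(** * The four inequalities *)

(** The numbers of Taylor terms in the four lemmas below are small ones for which
    the numerator of the resulting rational inequality has nonnegative
    coefficients in [x - 1]. *)
Lemma trigamma_lt_theta1 (x : R) : 1 <= x ->
  trigamma (x + 1) < theta x 1 + 1 / (24 * x ^ 5).
Proof.
  intros Hx.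
  apply Rle_lt_trans with (1 := trigamma_le_stirling7 x Hx).
  assert (H := theta_lower 6 3 x 1 ltac:(lra) ltac:(lra)).
  apply Rlt_le_trans with (2 := Rplus_le_compat_r _ _ _ H); clear H.
  unfold stirling7; simpl (2 * 3 + 1)%nat; expand_taylor.
  rational_lt x Hx.
Qed.

Lemma theta1_lt_trigamma (x : R) : 1 <= x ->
  theta x 1 + 1 / (24 * x ^ 5) - 5 / (48 * x ^ 6) < trigamma (x + 1).
Proof.
  intros Hx.
  apply Rlt_le_trans with (2 := stirling9_le_trigamma x Hx).
  assert (H := theta_upper 7 4 x 1 ltac:(lra) ltac:(lra)).
  apply Rle_lt_trans with
    (1 := Rplus_le_compat_r _ _ _ (Rplus_le_compat_r _ _ _ H)); clear H.
  unfold stirling9, stirling7; simpl (2 * 4)%nat; expand_taylor.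
  rational_lt x Hx.
Qed.

Lemma theta2_lt_trigamma (x : R) : 1 <= x ->
  theta x 2 - 1 / (45 * x ^ 7) < trigamma (x + 1).
Proof.
  intros Hx.
  apply Rlt_le_trans with (2 := stirling9_le_trigamma x Hx).
  assert (H := theta_upper 8 5 x 2 ltac:(lra) ltac:(lra)).
  apply Rle_lt_trans with (1 := Rplus_le_compat_r _ _ _ H); clear H.
  unfold stirling9, stirling7; simpl (2 * 5)%nat; expand_taylor.
  rational_lt x Hx.
Qed.

Lemma trigamma_lt_theta2 (x : R) : 1 <= x ->
  trigamma (x + 1) < theta x 2 - 1 / (45 * x ^ 7) + 7 / (90 * x ^ 8).
Proof.
  intros Hx.
  apply Rle_lt_trans with (1 := trigamma_le_stirling7 x Hx).
  assert (H := theta_lower 9 4 x 2 ltac:(lra) ltac:(lra)).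
  apply Rlt_le_trans with
    (2 := Rplus_le_compat_r _ _ _ (Rplus_le_compat_r _ _ _ H)); clear H.
  unfold stirling7; simpl (2 * 4 + 1)%nat; expand_taylor.
  rational_lt x Hx.
Qed.

Theorem theorem1p3 :
  forall x : R, 1 <= x ->
    (theta x 1 + 1 / (24 * x ^ 5) - 5 / (48 * x ^ 6) < trigamma (x + 1)
       < theta x 1 + 1 / (24 * x ^ 5))
    /\
    (theta x 2 - 1 / (45 * x ^ 7) < trigamma (x + 1)
       < theta x 2 - 1 / (45 * x ^ 7) + 7 / (90 * x ^ 8)).
Proof.
  intros x Hx; repeat split.
  - now apply theta1_lt_trigamma.
  - now apply trigamma_lt_theta1.
  - now apply theta2_lt_trigamma.
  - now apply trigamma_lt_theta2.
Qed.
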